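(* Every locally compact abelian group $G$ is approximable by finite loops.
   Context: A quasigroup is a set $Q$ with a binary operation $\circ$ such that for all $a,b\in Q$ each of $a\circ x=b$, $x\circ a=b$ has exactly one solution; a loop is a quasigroup having an element $e_Q$ with $a\circ e_Q=e_Q\circ a=a$ for all $a$. For a locally compact group $G$ with identity $e$, a compact $C\subseteq G$ and a neighborhood $U$ of $e$, a $(C,U)$-approximation by a finite loop is a pair $(Q,j)$ with $(Q,\circ)$ a finite loop and $j:Q\to G$ injective such that (a) $C\subseteq j(Q)U$ and (b) for all $a,b\in Q$ with $j(a),j(b)\in C$, $(j(a)j(b))^{-1}j(a\circ b)\in U$. $G$ is approximable by finite loops if such an approximation exists for every compact $C$ and every neighborhood $U$ of $e$. *)

(* Defs.v *)
From HB Require Import structures.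
From mathcomp Require Import all_boot all_order all_algebra.
From mathcomp Require Import all_classical all_reals all_analysis.
Set Implicit Arguments. Unset Strict Implicit. Unset Printing Implicit Defensive.
Import Order.TTheory GRing.Theory Num.Theory.
Local Open Scope classical_set_scope.
Local Open Scope ring_scope.

Definition is_quasigroup (Q : Type) (op : Q -> Q -> Q) : Prop :=
  forall a b : Q, (exists! x, op a x = b) /\ (exists! x, op x a = b).

Definition is_loop (Q : Type) (op : Q -> Q -> Q) : Prop :=
  is_quasigroup op /\ exists e : Q, forall a, op a e = a /\ op e a = a.

Definition CU_approximation (G : topologicalZmodType) (C U : set G)
    (Q : finType) (op : Q -> Q -> Q) (j : Q -> G) : Prop :=
  [/\ is_loop op, injective j,
      (forall c, C c -> exists a u, U u /\ c = j a + u) &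
      (forall a b : Q, C (j a) -> C (j b) -> U (j (op a b) - (j a + j b)))].

Definition approximable_by_finite_loops (G : topologicalZmodType) : Prop :=
  forall (C U : set G), compact C -> nbhs (0 : G) U ->
    exists (Q : finType) (op : Q -> Q -> Q) (j : Q -> G),
      CU_approximation C U op j.

(* Main.v *)
Require Import Defs.
From HB Require Import structures.
From mathcomp Require Import all_boot all_order all_algebra.
From mathcomp Require Import all_classical all_reals all_analysis.
From mathcomp Require Import zify.
Import Order.TTheory GRing.Theory Num.Theory.
Local Open Scope classical_set_scope.
Local Open Scope ring_scope.

(* Fix a small neighbourhood W of 0 and a finite net f_1, ..., f_d of C. Choosing
   greedily, one finds a lattice L (some Z^r) and p : L -> G such that only
   finitely many points of L are mapped to any given small translate c + V, while
   every f_i has a relation n_i f_i + p(l_i) in W with n_i > 0: an element without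
   such a relation is adjoined to L as a new free generator. Dividing L x Z^d by
   the relations (l_i, n_i e_i) and by a subgroup M of L of large finite index
   gives a finite abelian group, represented by the pairs (t, b) with t in a
   transversal of M and 0 <= b_i < n_i. When (t, b) + (t', b') lands near C + C, the
   lattice parts lie in a finite set fixed before M, so no reduction modulo M
   occurs, and reducing the b-part costs at most one copy of each of the d errors
   n_i f_i + p(l_i). If G is not discrete, a small perturbation makes the map to G
   injective. If G is discrete the relations hold exactly (W = {0}), and one works
   instead with representatives in G modulo p(M), chosen to contain C and C + C. *)

(** * Neighbourhoods of zero, finite nets and perturbation *)

Lemma nbhs0_sub (G : topologicalZmodType) (U : set G) : nbhs (0 : G) U ->
  exists2 V : set G, nbhs (0 : G) V & forall x y, V x -> V y -> U (x - y).
Proof.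
move=> U0; have U00 : nbhs ((0 : G) - 0) U by rewrite subr0.
have /= [[A B] /= [A0 B0] AB] := @sub_continuous G (0, 0) U U00.
exists (A `&` B) => [|x y [Ax _] [_ By]]; first exact: filterI.
exact: (AB (x, y)).
Qed.

Lemma nbhs0_add (G : topologicalZmodType) (U : set G) : nbhs (0 : G) U ->
  exists2 V : set G, nbhs (0 : G) V & forall x y, V x -> V y -> U (x + y).
Proof.
move=> U0; have U00 : nbhs ((0 : G) + 0) U by rewrite addr0.
have /= [[A B] /= [A0 B0] AB] := @add_continuous G (0, 0) U U00.
exists (A `&` B) => [|x y [Ax _] [_ By]]; first exact: filterI.
exact: (AB (x, y)).
Qed.

Lemma nbhs0_sum (G : topologicalZmodType) (d : nat) (U : set G) :
  nbhs (0 : G) U -> exists2 V : set G, nbhs (0 : G) V &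
    forall w : 'I_d -> G, (forall i, V (w i)) -> U (\sum_i w i).
Proof.
elim: d U => [|d IHd] U U0.
  exists U => // w _; rewrite big_ord0; exact: nbhs_singleton.
have [A A0 AU] := nbhs0_add _ _ U0; have [B B0 BA] := IHd _ A0.
exists (A `&` B) => [|w ABw]; first exact: filterI.
rewrite big_ord_recr; apply: AU; last by case: (ABw ord_max).
by apply: BA => i; case: (ABw (widen_ord (leqnSn d) i)).
Qed.

Lemma compact_finite_net (G : topologicalZmodType) (C V : set G) :
  compact C -> nbhs (0 : G) V ->
  exists s : seq G, forall c, C c -> exists2 x, x \in s & V (c - x).
Proof.
(* [compact_cover] is stated for pointed spaces only; [0] is taken as the point. *)
move=> Ccpt V0.
pose P : ptopologicalType := HB.pack (TopologicalZmodule.sort G)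
  (TopologicalZmodule.class G) (isPointed.Build G 0).
have {}Ccpt : @cover_compact G C.
  by have := Ccpt; rewrite -[@compact G]/(@compact P) compact_cover.
have tV (x : G) : open [set y | V° (y - x)].
  apply: (@open_comp _ _ (fun y : G => y - x)) => [y _|]; last exact: open_interior.
  apply: (@continuous_comp _ _ _ (fun y : G => (y, x)) (fun z : G * G => z.1 - z.2)).
    by apply: cvg_pair; [exact: cvg_id|exact: cvg_cst].
  exact: sub_continuous.
have [|D _ CD] := Ccpt G setT _ (fun x _ => tV x).
  by move=> c _; exists c => //=; rewrite subrr.
exists (finmap.enum_fset D) => c /CD[x /= xD Vcx]; exists x => //.
exact: interior_subset.
Qed.

(** Finite sets are closed here, so if a translate of [V] lay inside a finite set, some
    neighbourhood of [0] would shrink to the single point [0]. Values can thus be chosen one by one,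
    each avoiding the previous ones. *)
Lemma perturb_injective (G : topologicalZmodType) (V : set G) (Z : eqType)
    (D : seq Z) (q : Z -> G) :
  hausdorff_space G -> ~ nbhs (0 : G) [set 0] -> nbhs (0 : G) V ->
  exists2 j : Z -> G, {in D &, injective j} & forall z, z \in D -> V (j z - q z).
Proof.
move=> /hausdorff_accessible Gacc not_discrete V0.
have avoid (s : seq G) (p : G) : exists2 u, V u & p + u \notin s.
  apply: contrapT => noU; apply: not_discrete.
  pose A := [set` [seq x - p | x <- s]] `\ 0.
  have /closed_openC openA : closed A.
    apply: (accessible_finite_set_closed.1 Gacc).
    by apply: finite_setD; exact: finite_seq.
  have A0 : nbhs (0 : G) (~` A) by apply: open_nbhs_nbhs; split => //; case=> _; apply.
  apply: filterS (filterI V0 A0) => u [Vu nAu] /=.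
  apply: contrapT => u0; apply: noU; exists u => //.
  apply/negP => pus; apply: nAu; split => //=.
  by apply/mapP; exists (p + u); rewrite // addrAC subrr add0r.
elim: D => [|a D [j jinj jV]]; first by exists q.
have [u Vu nu] := avoid (map j D) (q a).
have [aD|aD] := boolP (a \in D).
  have sub : {subset a :: D <= D} by move=> x; rewrite inE => /predU1P[->|].
  by exists j => [x y /sub xD /sub yD|x /sub]; [exact: jinj|exact: jV].
have neq z : z \in D -> (z == a) = false.
  by move=> zD; apply: contraNF aD => /eqP <-.
have nju z : z \in D -> j z != q a + u.
  by move=> zD; apply: contraNneq nu => <-; exact: map_f.
exists (fun z => if z == a then q a + u else j z).
  move=> x y; rewrite !inE => /predU1P[->|xD] /predU1P[->|yD] //; rewrite ?eqxx ?neq //.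
  - by move=> /esym /eqP; rewrite (negPf (nju _ yD)).
  - by move=> /eqP; rewrite (negPf (nju _ xD)).
  - exact: jinj.
move=> z; rewrite inE => /predU1P[->|zD]; first by rewrite eqxx addrAC subrr add0r.
by rewrite neq //; exact: jV.
Qed.

(** * Systems of representatives and the loops they carry *)

Definition subgroup {Z : zmodType} (M : set Z) :=
  M 0 /\ forall x y, M x -> M y -> M (x - y).

Definition incongruent {Z : zmodType} (M : set Z) (T : seq Z) :=
  {in T &, forall x y, M (x - y) -> x = y}.

Lemma subgroupN {Z : zmodType} (M : set Z) x : subgroup M -> M x -> M (- x).
Proof. by move=> [M0 MB] Mx; rewrite -sub0r; exact: MB. Qed.

Lemma subgroup_trans {Z : zmodType} (M : set Z) y x z :
  subgroup M -> M (x - y) -> M (y - z) -> M (x - z).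
Proof.
move=> sM Mxy /(subgroupN _ _ sM); rewrite opprB => Myz.
by have := sM.2 _ _ Mxy Myz; rewrite opprB addrA subrK.
Qed.

(** Greedy choice: an element of [s2] is kept only if it is incongruent to everything kept before.
    All of [s1] survives, so prescribed elements can be made to represent themselves. *)
Lemma incongruent_extend (Z : zmodType) (M : set Z) (s1 s2 : seq Z) :
  subgroup M -> incongruent M s1 ->
  exists D : seq Z, [/\ incongruent M D, {subset s1 <= D},
    {subset D <= s1 ++ s2} &
    forall x, x \in s2 -> exists2 t, t \in D & M (x - t)].
Proof.
move=> sM; elim: s2 s1 => [|a s2 IHs2] s1 sep1.
  by exists s1; split => // x; rewrite mem_cat => ->.
have [[t ts1 Mat]|no_t] := pselect (exists2 t, t \in s1 & M (a - t)).
  have [D [sepD s1D Ds s2D]] := IHs2 _ sep1; exists D; split => //.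
    by move=> x /Ds; rewrite !mem_cat inE => /orP[]->; rewrite ?orbT.
  by move=> x; rewrite inE => /predU1P[->|/s2D//]; exists t => //; exact: s1D.
have sep1a : incongruent M (a :: s1).
  move=> x y; rewrite !inE => /predU1P[->|xs] /predU1P[->|ys] // Mxy.
  - by case: no_t; exists y.
  - by case: no_t; exists x => //; rewrite -opprB; exact: subgroupN.
  - exact: sep1.
have [D [sepD s1D Ds s2D]] := IHs2 _ sep1a; exists D; split => //.
- by move=> x xs; apply: s1D; rewrite inE xs orbT.
- by move=> x /Ds; rewrite !mem_cat !inE => /orP[/orP[]|] ->; rewrite ?orbT.
move=> x; rewrite inE => /predU1P[->|/s2D//]; exists a; last by rewrite subrr; case: sM.
by apply: s1D; rewrite inE eqxx.
Qed.

(* The loop operation sends two representatives to the representative of their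
   sum modulo [M]; cancellation modulo [M] makes it a Latin square. *)
Lemma approximation_of_representatives (G : topologicalZmodType) (C U : set G)
    (Z : zmodType) (M : set Z) (D : seq Z) (j : Z -> G) :
  subgroup M -> incongruent M D -> 0 \in D -> {in D &, injective j} ->
  (forall c, C c -> exists2 a, a \in D & U (c - j a)) ->
  (forall x y, x \in D -> y \in D -> exists z, [/\ z \in D, M (x + y - z) &
     (C (j x) -> C (j y) -> U (j z - (j x + j y)))]) ->
  exists (Q : finType) (op : Q -> Q -> Q) (j' : Q -> G),
    CU_approximation C U op j'.
Proof.
move=> sM sepD D0 jinj Ccov sumD.
have /choice[op opP] : forall ab : seq_sub D * seq_sub D, exists z : seq_sub D,
    M (val ab.1 + val ab.2 - val z) /\
    (C (j (val ab.1)) -> C (j (val ab.2)) ->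
     U (j (val z) - (j (val ab.1) + j (val ab.2)))).
  move=> [a b] /=; have [z [zD Mz Uz]] := sumD _ _ (valP a) (valP b).
  by exists (SeqSub zD).
have opM a b : M (val a + val b - val (op (a, b))) by case: (opP (a, b)).
have eq_val (a b : seq_sub D) : M (val a - val b) -> a = b.
  by move=> Mab; apply/val_inj; apply: sepD Mab; exact: valP.
have injl a : injective (fun x => op (a, x)).
  move=> x y /= opxy; apply: eq_val; have := sM.2 _ _ (opM a x) (opM a y).
  by rewrite opxy opprB addrA subrK opprD addrACA subrr add0r.
have opC a b : op (a, b) = op (b, a).
  apply: eq_val; have := sM.2 _ _ (opM b a) (opM a b).
  by rewrite [val b + _]addrC opprB [X in M X]addrC addrA subrK.
exists (seq_sub D : finType), (fun a b => op (a, b)), (fun a => j (val a)).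
(* An injective self-map of a finite type is bijective, which gives division on one side;
   commutativity gives the other side. *)
have uniq_sol a b : exists! x, op (a, x) = b.
  have [g gK Kg] := injF_bij (injl a); exists (g b); split; first exact: Kg.
  by move=> x <-; exact: gK.
split.
- split; first move=> a b.
    split => //; have [x [opx xu]] := uniq_sol a b; exists x.
    by split => [|y]; rewrite opC //; exact: xu.
  exists (SeqSub D0) => a; rewrite [op (SeqSub D0, a)]opC.
  suff : op (a, SeqSub D0) = a by [].
  by apply: eq_val; have := subgroupN _ _ sM (opM a (SeqSub D0)); rewrite opprB /= addr0.
- by move=> a b /jinj ab; apply/val_inj/ab; exact: valP.
- move=> c /Ccov[a aD Uca]; exists (SeqSub aD), (c - j a).
  by split => //=; rewrite [RHS]addrC subrK.
- by move=> a b; exact: (opP (a, b)).2.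
Qed.

(** * Residually finite lattices *)

(** Residual finiteness in the form used below: the elements of [s] are their own representatives in
    a full finite transversal, so reduction modulo [M] leaves them unchanged. *)
Definition residually_finite (L : zmodType) : Prop :=
  forall s : seq L, exists (M : set L) (T : seq L),
    [/\ subgroup M, incongruent M T, {subset s <= T} &
        forall x, exists2 t, t \in T & M (x - t)].

Lemma residually_finite_mul_int (L : zmodType) :
  residually_finite L -> residually_finite (L * int)%type.
Proof.
move=> Lrf s; have [M [T [sM sepT sT MT]]] := Lrf (map fst s).
have [N sN] : exists N : nat, forall x : L * int, x \in s -> (`|x.2| < N)%N.
  elim: s {sT} => [|a s [N sN]]; first by exists 0%N.
  exists (N + `|a.2| + 1)%N => x; rewrite inE => /predU1P[->|/sN xN]; last by lia.
  by rewrite addn1 ltnS leq_addl.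
have N0 : (N%:Z + N%:Z + 2 : int) != 0 by lia.
(* The subgroup will be M x mZ. Since [m] counts the integers of [I], from -N to N + 1, [I] is a
   complete residue system modulo [m], and it contains all second coordinates from [s]; the summand
   2 keeps [m] nonzero when [N] is 0. *)
pose m : int := N%:Z + N%:Z + 2.
pose I := [seq i%:Z - N%:Z | i <- iota 0 (N + N + 2)].
have IP (z : int) : (z \in I) = (- N%:Z <= z) && (z < N%:Z + 2).
  apply/mapP/idP => [[i]|/andP[Nz zN]]; first by rewrite mem_iota => /andP[_]; lia.
  by exists (absz (z + N%:Z)); rewrite ?mem_iota; lia.
exists [set x : L * int | M x.1 /\ exists k, x.2 = k * m],
  [seq (t, i) | t <- T, i <- I].
split.
- split; first by split; [exact: sM.1|exists 0; rewrite mul0r].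
  move=> x y [Mx [k xk]] [My [l yl]]; split; first exact: sM.2.
  by exists (k - l); rewrite mulrBl -xk -yl.
- move=> _ _ /allpairsP[[t i] /= [tT iI ->]] /allpairsP[[t' i'] /= [tT' iI' ->]].
  move=> [/= Mtt [k kP]].
  congr pair; first exact: sepT.
  move: iI iI'; rewrite !IP => iI iI'; move: kP; rewrite /m => kP.
  have [k0|[k1|k1]] : k = 0 \/ 1 <= k \/ k <= -1 by lia.
  - by move: kP; rewrite k0 mul0r => /eqP; rewrite subr_eq0 => /eqP.
  - by nia.
  - by nia.
- move=> [l z] lzs; apply/allpairsP; exists (l, z); split => //=.
    by apply: sT; apply/mapP; exists (l, z).
  by rewrite IP; have /= := sN _ lzs; lia.
- move=> [l z]; have [t tT Mlt] := MT l.
  exists (t, ((z + N%:Z) %% m)%Z - N%:Z); last first.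
    split => //=; exists ((z + N%:Z) %/ m)%Z.
    by have := divz_eq (z + N%:Z) m; lia.
  apply/allpairsP; exists (t, ((z + N%:Z) %% m)%Z - N%:Z); split => //=.
  by rewrite IP; have := modz_ge0 (z + N%:Z) N0;
    have := @ltz_pmod (z + N%:Z) m; rewrite /m; lia.
Qed.

(** * Adjoining free generators *)

Definition adjoin (L G : zmodType) (p : L -> G) (f : G) (x : L * int) : G :=
  p x.1 + f *~ x.2.

Fact adjoin_is_zmod_morphism (L G : zmodType) (p : {additive L -> G}) (f : G) :
  zmod_morphism (adjoin L G p f).
Proof.
by move=> x y; rewrite /adjoin raddfB mulrzBr opprD addrACA.
Qed.

HB.instance Definition _ (L G : zmodType) (p : {additive L -> G}) (f : G) :=
  GRing.isZmodMorphism.Build (L * int)%type G (adjoin L G p f)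
    (adjoin_is_zmod_morphism L G p f).

(* An element [f] that is not torsion modulo the image of [p], up to [W], is
   adjoined as a free generator; otherwise [p] is kept. *)
Lemma proper_lattice (G : zmodType) (W V : set G) (F : seq G) :
  V 0 -> (forall x y, V x -> V y -> W (x - y)) ->
  exists (L : zmodType) (p : {additive L -> G}),
    [/\ residually_finite L,
        forall c, exists s : seq L, forall l, V (p l - c) -> l \in s &
        forall f, f \in F -> exists n (l : L), (0 < n)%N /\ W (f *+ n + p l)].
Proof.
move=> V0 VW; have W0 : W 0 by rewrite -(subr0 0); exact: VW.
elim: F => [|f F [L [p [Lrf pV pF]]]].
  (* Row vectors of length 0 form the trivial group, the lattice of rank 0. *)
  exists 'rV[int]_0, (\0 : {additive 'rV[int]_0 -> G}); split => //.
    move=> s; exists setT, [:: 0]; split => //.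
    - by move=> x y _ _ _; rewrite [x]thinmx0 [y]thinmx0.
    - by move=> x _; rewrite [x]thinmx0 mem_head.
    - by move=> x; exists 0; rewrite ?mem_head.
  by move=> c; exists [:: 0] => l _; rewrite [l]thinmx0 mem_head.
have [[n [l [n0 Wf]]]|free_f] :=
  pselect (exists n (l : L), (0 < n)%N /\ W (f *+ n + p l)).
  exists L, p; split => // g; rewrite inE => /predU1P[->|/pF//].
  by exists n, l.
exists (L * int)%type, (adjoin L G p f : {additive (L * int)%type -> G}); split.
- exact: residually_finite_mul_int.
- move=> c; have [[[l0 z0] V0z]|none] :=
    pselect (exists x, V (adjoin L G p f x - c)); last first.
    by exists [::] => x Vx; case: none; exists x.
  (* Subtracting two points over the same translate with distinct last coordinates would give a
     positive multiple of [f] a relation in [W]. So the last coordinate is constant there, equal to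
     [z0], and finiteness follows from that for [p]. *)
  have le_snd x y : V (adjoin L G p f x - c) -> V (adjoin L G p f y - c) -> x.2 <= y.2.
    move=> Vx Vy; rewrite leNgt; apply/negP => yx; apply: free_f.
    exists (absz (x.2 - y.2)), (x.1 - y.1); split.
      by rewrite absz_gt0 subr_eq0 gt_eqF.
    have -> : f *+ absz (x.2 - y.2) = f *~ (x.2 - y.2).
      by rewrite pmulrn gez0_abs // subr_ge0 ltW.
    have := VW _ _ Vx Vy; rewrite opprB addrA subrK -raddfB.
    by rewrite [X in _ -> W X]addrC.
  have [s sP] := pV (c - f *~ z0).
  exists [seq (l, z0) | l <- s] => -[l z] Vz.
  have zz0 : z = z0.
    apply/le_anti/andP; split; first exact: (le_snd _ _ Vz V0z).
    exact: (le_snd _ _ V0z Vz).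
  rewrite zz0 in Vz *; apply: map_f; apply: sP.
  by move: Vz; rewrite /adjoin /= opprB addrA.
- move=> g; rewrite inE => /predU1P[->|/pF[n [l [n0 Wg]]]].
    (* The new generator maps to [f], which gives the exact relation f - f = 0. *)
    exists 1%N, (0, -1); split => //.
    by rewrite /= /adjoin /= raddf0 add0r mulrN1z mulr1n subrr.
  by exists n, (l, 0); rewrite /= /adjoin /= mulr0z addr0.
Qed.

(** * Reduction modulo the relations in L x Z^d *)

Definition combine {L G : zmodType} {d : nat} (p : L -> G) (f : 'I_d -> G)
  (x : L * {ffun 'I_d -> int}) : G := p x.1 + \sum_i f i *~ x.2 i.

Lemma combineD (L G : zmodType) (d : nat) (p : {additive L -> G}) (f : 'I_d -> G)
  (x y : L * {ffun 'I_d -> int}) :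
  combine p f (x + y) = combine p f x + combine p f y.
Proof.
rewrite /combine raddfD addrACA -big_split; congr (_ + _).
by apply: eq_bigr => i _; rewrite ffunE mulrzDr.
Qed.

Definition quotients {d : nat} (n : 'I_d -> nat) (y : {ffun 'I_d -> int}) :=
  [ffun i => (y i %/ n i)%Z].

Definition remainders {d : nat} (n : 'I_d -> nat) (y : {ffun 'I_d -> int}) :=
  [ffun i => (y i %% n i)%Z].

(** Subtracting from [x] each relation (l_i, n_i e_i) as often as [quotients n x.2 i] says leaves a
    pair with second component [remainders n x.2]; this is its first component. *)
Definition carry {L : zmodType} {d : nat} (n : 'I_d -> nat) (l : 'I_d -> L)
  (x : L * {ffun 'I_d -> int}) : L := x.1 - \sum_i l i *~ quotients n x.2 i.

(** For a subgroup [M], this is the subgroup generated by M x 0 and the relations (l_i, n_i e_i),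
    with [k] recording the coefficients of the relations. *)
Definition relation_subgroup {L : zmodType} {d : nat} (M : set L)
    (n : 'I_d -> nat) (l : 'I_d -> L) : set (L * {ffun 'I_d -> int}) :=
  [set x : L * {ffun 'I_d -> int} | exists k : 'I_d -> int,
     (forall i, x.2 i = k i * n i) /\ M (x.1 - \sum_i l i *~ k i)].

(** The map is additive and sends the relation (l_i, n_i e_i) to [f i *+ n i + p (l i)], so the last
    sum is the exact cost of the reduction. *)
Lemma combine_carry (L G : zmodType) (d : nat) (p : {additive L -> G})
    (f : 'I_d -> G) (n : 'I_d -> nat) (l : 'I_d -> L) (x : L * {ffun 'I_d -> int}) :
  combine p f x = combine p f (carry n l x, remainders n x.2)
    + \sum_i (f i *+ n i + p (l i)) *~ quotients n x.2 i.
Proof.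
rewrite /combine /= raddfB raddf_sum.
have -> : \sum_i (f i *+ n i + p (l i)) *~ quotients n x.2 i =
    \sum_i f i *+ n i *~ quotients n x.2 i + \sum_i p (l i *~ quotients n x.2 i).
  by rewrite -big_split /=; apply: eq_bigr => i _; rewrite mulrzDl raddfMz.
rewrite [X in _ = _ + X]addrC addrACA subrK -big_split /=; congr (_ + _).
apply: eq_bigr => i _; rewrite !ffunE pmulrn -mulrzA -mulrzDr; congr (_ *~ _).
by rewrite addrC mulrC -divz_eq.
Qed.

Lemma subgroup_relation (L : zmodType) (d : nat) (M : set L) (n : 'I_d -> nat)
    (l : 'I_d -> L) : subgroup M -> subgroup (relation_subgroup M n l).
Proof.
move=> [M0 MB]; split.
  exists (fun=> 0); split => [i|]; first by rewrite ffunE mul0r.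
  by rewrite big1 ?subrr.
move=> x y [k [xk Mx]] [h [yh My]]; exists (fun i => k i - h i); split.
  by move=> i; rewrite !ffunE xk yh mulrBl.
under eq_bigr do rewrite mulrzBr.
rewrite sumrB; have := MB _ _ Mx My.
by rewrite /= !opprD !opprK [X in M X -> _]addrACA.
Qed.

Lemma carry_relation (L : zmodType) (d : nat) (M : set L) (n : 'I_d -> nat)
    (l : 'I_d -> L) (x : L * {ffun 'I_d -> int}) (t : L) :
  M (carry n l x - t) -> relation_subgroup M n l (x - (t, remainders n x.2)).
Proof.
move=> Mxt; exists (quotients n x.2); split; last by rewrite /= addrAC.
by move=> i; rewrite !ffunE [X in X - _](divz_eq _ (n i)) addrK.
Qed.

Lemma int_box (d : nat) (n : 'I_d -> nat) : exists B : seq {ffun 'I_d -> int},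
  forall y, y \in B = [forall i, 0 <= y i < n i].
Proof.
exists [seq [ffun i => (g i : nat)%:Z] | g : {dffun forall i, 'I_(n i)}] => y.
apply/mapP/forallP => [[g _ ->] i|yn]; first by rewrite ffunE /= ltz_nat ltn_ord.
have yi i : (absz (y i) < n i)%N by have := yn i; lia.
exists [ffun i => Ordinal (yi i)]; first by rewrite mem_enum.
by apply/ffunP => i; rewrite !ffunE /= gez0_abs //; case/andP: (yn i).
Qed.

Lemma remainders_box (d : nat) (n : 'I_d -> nat) (y : {ffun 'I_d -> int}) :
  (forall i, (0 < n i)%N) -> [forall i, 0 <= remainders n y i < n i].
Proof.
move=> n0; apply/forallP => i; rewrite ffunE.
have ni : (n i : int) != 0 by have := n0 i; lia.
by rewrite modz_ge0 //= ltz_pmod //; have := n0 i; lia.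
Qed.

Lemma int_congruent_eq0 (u v k : int) (n : nat) :
  0 <= u < n -> 0 <= v < n -> u - v = k * n -> k = 0.
Proof.
move=> un vn uvk.
have [//|[k1|k1]] : k = 0 \/ 1 <= k \/ k <= -1 by lia.
- by nia.
- by nia.
Qed.

(** A multiple of n_i that is a difference of two elements of [0, n_i) is 0. So all coefficients
    [k i] vanish, and the first components are congruent modulo [M]. *)
Lemma incongruent_box (L : zmodType) (d : nat) (M : set L) (n : 'I_d -> nat)
    (l : 'I_d -> L) (T : seq L) (B : seq {ffun 'I_d -> int}) :
  (forall y, y \in B = [forall i, 0 <= y i < n i]) -> incongruent M T ->
  incongruent (relation_subgroup M n l) [seq (t, b) | t <- T, b <- B].
Proof.
move=> BP incT _ _ /allpairsP[[t b] /= [tT bB ->]]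
  /allpairsP[[t' b'] /= [tT' bB' ->]] [k [/= kP Mk]].
move: bB bB'; rewrite !BP => /forallP bn /forallP bn'.
have k0 i : k i = 0.
  apply: (int_congruent_eq0 _ _ _ (n i)); [exact: bn|exact: bn'|].
  by have := kP i; rewrite !ffunE.
congr pair; last first.
  apply/ffunP => i; apply/eqP; have := kP i.
  by rewrite k0 mul0r !ffunE => /eqP; rewrite subr_eq0.
by apply: incT => //; move: Mk; rewrite big1 ?subr0 // => i _; rewrite k0.
Qed.

Lemma combine_delta (L G : zmodType) (d : nat) (p : {additive L -> G})
    (f : 'I_d -> G) (i : 'I_d) :
  combine p f (0, [ffun j => (j == i)%:Z]) = f i.
Proof.
rewrite /combine /= raddf0 add0r (bigD1 i) //= ffunE eqxx mulr1z big1 ?addr0 //.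
by move=> j /negPf ji; rewrite ffunE ji mulr0z.
Qed.

Lemma finite_fibers_seq (I L : eqType) (P : I -> L -> Prop) (r : seq I) :
  (forall c, exists s : seq L, forall l, P c l -> l \in s) ->
  exists s : seq L, forall c l, c \in r -> P c l -> l \in s.
Proof.
move=> Pfin; elim: r => [|c r [s sP]]; first by exists [::].
have [s' s'P] := Pfin c; exists (s' ++ s) => c' l; rewrite inE mem_cat.
by move=> /predU1P[->|cr] Pl; rewrite ?(s'P _ Pl) ?(sP _ _ cr Pl) ?orbT.
Qed.

(** * The discrete case *)

Lemma discrete_approximable (G : topologicalZmodType) :
  nbhs (0 : G) [set 0] -> approximable_by_finite_loops G.
Proof.
move=> G0 C U Ccpt U0.
have [s sC] := compact_finite_net _ _ _ Ccpt G0.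
have Cs c : C c -> c \in s by move=> /sC[x xs /eqP]; rewrite subr_eq0 => /eqP ->.
have [||L [p [Lrf pfib pF]]] := @proper_lattice G [set 0] [set 0] s => //.
  by move=> x y -> ->; rewrite /= subr0.
pose d := size s; pose f (i : 'I_d) := nth 0 s i.
have /choice[nl nlP] (i : 'I_d) : exists nl : nat * L,
    (0 < nl.1)%N /\ f i *+ nl.1 + p nl.2 = 0.
  by have [n [l nlP]] := pF (f i) (mem_nth _ (ltn_ord i)); exists (n, l).
pose n i := (nl i).1; pose l i := (nl i).2.
have [B BP] := int_box _ n.
pose S1 := 0 :: s ++ [seq x + y | x <- s, y <- s].
(* An element of [M] whose image is a difference of two elements of [S1] will lie in [sL], hence in
   [T] together with [0], so it is [0]. Thus [S1] stays incongruent modulo p(M). *)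
have [sL sLP] := finite_fibers_seq _ _ _ [seq x - y | x <- S1, y <- S1] pfib.
have [M [T [sM incT sT MT]]] := Lrf (0 :: sL).
have T0 : 0 \in T by apply: sT; rewrite mem_head.
pose MG : set G := [set g | exists2 m, M m & p m = g].
have sMG : subgroup MG.
  split; first by exists 0; [exact: sM.1|rewrite raddf0].
  by move=> _ _ [m Mm <-] [m' Mm' <-]; exists (m - m'); [exact: sM.2|rewrite raddfB].
have incS1 : incongruent MG S1.
  move=> x y xS yS [m Mm pm].
  have m0 : m = 0.
    apply: incT => //; last by rewrite subr0.
    apply: sT; rewrite inE; apply/orP; right.
    by apply: (sLP (x - y)); [by apply/allpairsP; exists (x, y)|rewrite pm /= subrr].
  by apply/eqP; rewrite -subr_eq0 -pm m0 raddf0.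
pose S2 := [seq combine p f (t, b) | t <- T, b <- B].
have [D [incD S1D DS S2D]] := incongruent_extend _ _ _ S2 sMG incS1.
(* The relations are exact, so reducing costs nothing: [S2] meets the coset modulo [MG] of every
   value of [combine p f]. *)
have reduce z : exists2 t, t \in D & MG (combine p f z - t).
  rewrite (combine_carry _ _ _ p f n l) [X in _ + X]big1 ?addr0; last first.
    by move=> i _; rewrite (nlP i).2 mul0rz.
  have [t tT Mt] := MT (carry n l z).
  have rB : remainders n z.2 \in B.
    by rewrite BP; apply: remainders_box => i; case: (nlP i).
  have [|g gD MGg] := S2D (combine p f (t, remainders n z.2)).
    by apply/allpairsP; exists (t, remainders n z.2).
  exists g => //; apply: subgroup_trans MGg => //.
  exists (carry n l z - t) => //.
  by rewrite /combine /= raddfB opprD addrACA subrr addr0.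
have combine_s x : x \in s -> exists z, x = combine p f z.
  move=> xs; have xd : (index x s < d)%N by rewrite index_mem.
  exists (0, [ffun j => (j == Ordinal xd)%:Z]).
  by rewrite combine_delta /f nth_index.
(* Reduction has been established only for values of [combine p f], so the representatives must be
   such values. *)
have combine_D x : x \in D -> exists z, x = combine p f z.
  move=> /DS; rewrite mem_cat inE mem_cat => /orP[/predU1P[->|/orP[/combine_s//|]]|].
  - exists 0; rewrite /combine raddf0 add0r big1 // => i _.
    by rewrite ffunE mulr0z.
  - move=> /allpairsP[[a b] /= [/combine_s[z ->] /combine_s[z' ->] ->]].
    by exists (z + z'); rewrite combineD.
  - by move=> /allpairsP[[a b] /= [_ _ ->]]; exists (a, b).
apply: (approximation_of_representatives _ _ _ _ MG D id) => //.
- by apply: S1D; rewrite mem_head.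
- move=> c /Cs cs; exists c; last by rewrite subrr; exact: nbhs_singleton.
  by apply: S1D; rewrite inE mem_cat cs orbT.
- move=> x y xD yD; have [[Cx Cy]|nC] := pselect (C x /\ C y).
    (* Here [x + y] belongs to [S1], so it is its own representative and the error is [0]. *)
    exists (x + y); rewrite !subrr; split; last 1 first.
    + by move=> _ _; exact: nbhs_singleton.
    + apply: S1D; rewrite inE mem_cat; apply/or3P/Or33.
      by apply/allpairsP; exists (x, y); rewrite /= !Cs.
    + exact: sMG.1.
  have [z xz] := combine_D _ xD; have [z' yz'] := combine_D _ yD.
  have [t tD Mt] := reduce (z + z'); exists t; split => //.
    by rewrite xz yz' -combineD.
  by move=> Cx Cy; case: nC.
Qed.

(** * The non-discrete case *)

(** The sum lies in [0, 2n). Hence adding two vectors of the box applies each relation at most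
    once. *)
Lemma div_sum_box (u v : int) (n : nat) :
  0 <= u < n -> 0 <= v < n -> ((u + v) %/ n)%Z = 0 \/ ((u + v) %/ n)%Z = 1.
Proof.
move=> un vn; have n0 : (0 < n)%N by lia.
have := divz_eq (u + v) n; have : 0 <= ((u + v) %% n)%Z < n.
  by rewrite modz_ge0 ?ltz_pmod; lia.
by set q := (_ %/ _)%Z; set r := (_ %% _)%Z; nia.
Qed.

Lemma nondiscrete_approximable (G : topologicalZmodType) :
  hausdorff_space G -> ~ nbhs (0 : G) [set 0] -> approximable_by_finite_loops G.
Proof.
move=> GH nG0 C U Ccpt U0.
(* The final error will be a difference of two elements of [A]: the perturbation at [z] minus that
   at [x] (through [A2]), and the perturbation at [y] plus the reduction error [S] (through
   [A3]). *)
have [A A0 AU] := nbhs0_sub _ _ U0.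
have [A2 A20 A2A] := nbhs0_sub _ _ A0; have [A3 A30 A3A] := nbhs0_add _ _ A0.
pose N := A `&` (A2 `&` A3).
have N0 : nbhs (0 : G) N by do 2?apply: filterI.
have [s0 s0C] := compact_finite_net _ _ _ Ccpt N0.
pose d := size s0; pose f (i : 'I_d) := nth 0 s0 i.
have [W W0 WN] := nbhs0_sum _ d _ N0.
have [W1 W10 W1W] := nbhs0_add _ _ W0.
have [V V0 VW1] := nbhs0_sub _ _ W10.
have [V1 V10 V1V] := nbhs0_sub _ _ V0.
have [s1 s1C] := compact_finite_net _ _ _ Ccpt V10.
have [||L [p [Lrf pfib pF]]] := @proper_lattice G W1 V s0 => //.
  exact: nbhs_singleton.
(* Doubling each relation, which enlarges [W1] to [W], makes every n_i at least 2. The unit vector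
   e_i then fits in the box and can represent [f i]. *)
have /choice[nl nlP] (i : 'I_d) : exists nl : nat * L,
    (1 < nl.1)%N /\ W (f i *+ nl.1 + p nl.2).
  have [n [l [n0 Wnl]]] := pF (f i) (mem_nth _ (ltn_ord i)).
  exists ((n + n)%N, l + l); split.
    by rewrite /= addnn -[1%N]/(0.*2.+1) ltn_Sdouble.
  by rewrite mulrnDr raddfD addrACA; exact: W1W.
pose n i := (nl i).1; pose l i := (nl i).2.
have n0 i : (0 < n i)%N by apply: ltnW; case: (nlP i).
have [B BP] := int_box _ n.
(* If [(t, b)] is a representative with [j (t, b)] in [C], then [p t] lies in the translate of [V]
   by an element of [cs]. So [ts] captures every such [t] before [M] is chosen. *)
pose cs := [seq c - \sum_i f i *~ (b : {ffun 'I_d -> int}) i | c <- s1, b <- B].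
have [ts tsP] := finite_fibers_seq _ _ _ cs pfib.
pose D1 := [seq (t, b) | t <- ts, b <- B].
(* The image of [M] in [G] need not be near [0], so the carries of sums of points over [C] are put
   into [T] itself. *)
have [M [T [sM incT sT MT]]] := Lrf (0 :: [seq carry n l (x + y) | x <- D1, y <- D1]).
pose D := [seq (t, b) | t <- T, b <- B].
have inD t b : t \in T -> b \in B -> (t, b) \in D.
  by move=> tT bB; apply/allpairsP; exists (t, b).
have T0 : 0 \in T by apply: sT; rewrite mem_head.
(* Membership in [N] controls the approximation errors; membership in [V1] locates the points over
   [C] inside [D1]. *)
have P0 : nbhs (0 : G) (N `&` V1) by exact: filterI.
have [j jinj jP] := perturb_injective _ _ _ D (combine p f) GH nG0 P0.
have inD1 x : x \in D -> C (j x) -> x \in D1.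
  move=> xD /s1C[c cs1 Vc]; have [_ Vj] := jP _ xD.
  have := V1V _ _ Vc Vj; rewrite opprB addrC addrA subrK.
  move: xD => /allpairsP[[t b] /= [tT bB ->]] Vtb.
  apply/allpairsP; exists (t, b); split => //.
  apply: (tsP (c - \sum_i f i *~ b i)); first by apply/allpairsP; exists (c, b).
  by rewrite opprB addrA.
apply: (approximation_of_representatives _ _ _ _ (relation_subgroup M n l) D j) => //.
- exact: subgroup_relation.
- exact: incongruent_box.
- apply: inD => //; rewrite BP; apply/forallP => i; rewrite ffunE lexx /= ltz_nat.
  exact: n0.
- move=> c /s0C[x xs Nx]; have xd : (index x s0 < d)%N by rewrite index_mem.
  have eD : (0, [ffun k => (k == Ordinal xd)%:Z]) \in D.
    apply: inD => //; rewrite BP; apply/forallP => i; rewrite ffunE ltz_nat /=.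
    by apply: leq_ltn_trans (nlP i).1; case: eqP.
  exists (0, [ffun k => (k == Ordinal xd)%:Z]) => //.
  have [[Aj _] _] := jP _ eD; have := AU _ _ Nx.1 Aj.
  by rewrite combine_delta /f nth_index // opprB addrA subrK.
move=> x y xD yD; have rB : remainders n (x + y).2 \in B.
  by rewrite BP; exact: remainders_box.
(* Unless both images lie in [C], only congruence is required, and any representative serves. *)
have [[Cx Cy]|nC] := pselect (C (j x) /\ C (j y)); last first.
  have [t tT Mt] := MT (carry n l (x + y)).
  exists (t, remainders n (x + y).2); split; [exact: inD|exact: carry_relation|].
  by move=> Cx Cy; case: nC.
have cT : carry n l (x + y) \in T.
  apply: sT; rewrite inE; apply/orP; right.
  by apply/allpairsP; exists (x, y); rewrite /= !inD1.
set z := (carry n l (x + y), remainders n (x + y).2).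
have zD : z \in D by exact: inD.
exists z; split => //; first by apply: carry_relation; rewrite subrr; exact: sM.1.
move=> _ _; set S := \sum_i (f i *+ n i + p (l i)) *~ quotients n (x + y).2 i.
have NS : N S.
  apply: WN => i; have bx : 0 <= x.2 i < n i.
    by move: xD => /allpairsP[[t b] /= [_ bB ->]]; move: bB; rewrite BP => /forallP.
  have byy : 0 <= y.2 i < n i.
    by move: yD => /allpairsP[[t b] /= [_ bB ->]]; move: bB; rewrite BP => /forallP.
  rewrite !ffunE; have [->|->] := div_sum_box _ _ _ bx byy.
    by rewrite mulr0z; exact: nbhs_singleton.
  by rewrite mulr1z; case: (nlP i).
have qxy : combine p f x + combine p f y = combine p f z + S.
  by rewrite -combineD (combine_carry _ _ _ p f n l).
have [[_ [A2z _]] _] := jP _ zD; have [[_ [A2x _]] _] := jP _ xD.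
have [[_ [_ A3y]] _] := jP _ yD.
have := AU _ _ (A2A _ _ A2z A2x) (A3A _ _ A3y NS.2.2).
have -> : S = combine p f x + combine p f y - combine p f z.
  by rewrite qxy addrAC subrr add0r.
move: (j x) (j y) (j z) (combine _ _ x) (combine _ _ y) (combine _ _ z).
move=> a b c a' b' c'.
suff -> : c - c' - (a - a') - (b - b' + (a' + b' - c')) = c - (a + b) by [].
have -> : b - b' + (a' + b' - c') = b + a' - c'.
  by rewrite [a' + b']addrC !addrA subrK.
by rewrite !opprB addrAC !addrA subrK opprD addrA subrK
  addrAC [a + b]addrC opprD addrA addrAC.
Qed.

Theorem theorem7 (G : topologicalZmodType) :
  hausdorff_space G -> locally_compact [set: G] ->
  approximable_by_finite_loops G.
Proof.
move=> GH _; have [|] := pselect (nbhs (0 : G) [set 0]).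
  exact: discrete_approximable.
exact: nondiscrete_approximable.
Qed.
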